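(* For any integers $d,n\ge 2$, let $\mathcal{M}^2_{d,n}\subset \mathcal{C}^{d\times n}$ be the variety of $d\times n$ matrices over $\mathcal{C}$ of rank at most $2$. Then the positive tropicalization and the really positive tropicalization of $\mathcal{M}^2_{d,n}$ coincide and are equal to the set of $d\times n$ tropical matrices of Barvinok rank at most $2$: $$\mathrm{trop}_{\mathcal{C}^+}(\mathcal{M}^2_{d,n})=\mathrm{trop}_{\mathcal{R}^+}(\mathcal{M}^2_{d,n})=\{A\in\mathbb{R}^{d\times n} : A \text{ has Barvinok rank at most } 2\}.$$
   Context: Let $\mathcal{C}=\mathbb{C}\{\!\{t\}\!\}$ and $\mathcal{R}=\mathbb{R}\{\!\{t\}\!\}$ be the fields of complex and real Puiseux series, with valuation $\mathrm{val}(a)$ = the exponent of the leading (lowest degree) term of $a\neq 0$. Let $\mathcal{C}^+\subset\mathcal{C}$ and $\mathcal{R}^+\subset\mathcal{R}$ be the subsets of nonzero series whose leading coefficient is a positive real number. For a variety $X\subset\mathcal{C}^N$, define $\mathrm{trop}_{\mathcal{C}^+}(X)=\overline{\{\mathrm{val}(x): x\in X\cap(\mathcal{C}^+)^N\}}\subset\mathbb{R}^N$ (positive tropicalization) and $\mathrm{trop}_{\mathcal{R}^+}(X)=\overline{\{\mathrm{val}(x): x\in X\cap(\mathcal{R}^+)^N\}}\subset\mathbb{R}^N$ (really positive tropicalization), where valuation is coordinatewise and the closure is Euclidean. The tropical semiring is $(\mathbb{R},\oplus,\odot)$ with $x\oplus y=\min(x,y)$, $x\odot y=x+y$; matrix multiplication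 $B\odot C$ is with respect to these operations. The Barvinok rank of a $d\times n$ tropical (i.e. real) matrix $A$ is the smallest integer $r$ such that $A=B\odot C$ with $B\in\mathbb{R}^{d\times r}$ and $C\in\mathbb{R}^{r\times n}$. *)

(* Defs.v *)
From HB Require Import structures.
From mathcomp Require Import all_boot all_order all_algebra.
From mathcomp Require Import complex.
From mathcomp Require Import all_classical all_reals all_analysis.

Set Implicit Arguments.
Unset Strict Implicit.
Unset Printing Implicit Defensive.

Import Order.TTheory GRing.Theory Num.Theory.
Import numFieldNormedType.Exports.

Local Open Scope classical_set_scope.
Local Open Scope ring_scope.

(* (k + m) / n.+1 for k : int fixed and m = 0, 1, 2, ... are the exponents
   that may occur in a Puiseux series with denominator n.+1 starting at
   t ^ (k / n.+1). *)
Definition pexp (n : nat) (k : int) (m : nat) : rat :=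
  (k + m%:Z)%:~R / n.+1%:R.

Definition psupp (K : nmodType) (n : nat) (k : int) (f : rat -> K) : Prop :=
  forall q, f q != 0 -> exists m : nat, q = pexp n k m.

(* A Puiseux series sum_q f_q t^q is encoded by its coefficients q |-> f_q. *)
Record puiseux (K : nmodType) := Puiseux {
  pcoef :> rat -> K;
  pcoefP : exists n k, psupp n k pcoef }.

Section PuiseuxSupport.
Variable K : nmodType.
Implicit Types f g : rat -> K.

Lemma puiseux_eq (f g : puiseux K) : f =1 g -> f = g.
Proof.
case: f g => [f Hf] [g Hg] /= /funext fg; subst g.
by congr Puiseux; apply: Prop_irrelevance.
Qed.

Lemma pexp_inj n k : injective (pexp n k).
Proof.
move=> i j /(mulIf _) H; have {H} : (k + i%:Z)%:~R = (k + j%:Z)%:~R :> rat.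
  by apply: H; rewrite invr_eq0 pnatr_eq0.
by move/intr_inj/addrI => [].
Qed.

Lemma pexpD n k l i j : pexp n k i + pexp n l j = pexp n (k + l) (i + j).
Proof. by rewrite /pexp -mulrDl -intrD PoszD addrACA. Qed.

Lemma pexp_le n k i j : (pexp n k i <= pexp n k j) = (i <= j)%N.
Proof.
by rewrite /pexp ler_pM2r ?invr_gt0 ?ltr0n // ler_int lerD2l lez_nat.
Qed.

Lemma psuppW n k n' k' (c : nat) f : n'.+1 = (n.+1 * c.+1)%N ->
  k' <= k * c.+1%:Z -> psupp n k f -> psupp n' k' f.
Proof.
move=> En Ek Hf q /Hf [m ->]; exists (m * c.+1 + `|(k * c.+1%:Z - k')%R|)%N.
rewrite /pexp En natrM PoszD abszE ger0_norm ?subr_ge0 // PoszM.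
have -> : k' + (m%:Z * c.+1%:Z + (k * c.+1%:Z - k')) = (k + m%:Z) * c.+1%:Z.
  by rewrite mulrDl [k' + _]addrC -addrA subrK addrC.
by rewrite intrM -mulf_div divff ?mulr1 // pnatr_eq0.
Qed.

Lemma psupp_common (f g : puiseux K) :
  exists n k, psupp n k f /\ psupp n k g.
Proof.
case: f g => [f [n [k Hf]]] [g [n' [k' Hg]]] /=.
exists (n.+1 * n'.+1).-1, (Num.min (k * n'.+1%:Z) (k' * n.+1%:Z)).
by split; [apply: psuppW Hf | apply: psuppW Hg];
  rewrite ?prednK ?muln_gt0 // 1?mulnC // ge_min lexx ?orbT.
Qed.

Lemma psuppWk n k k' f : k' <= k -> psupp n k f -> psupp n k' f.
Proof. by move=> kk; apply: (@psuppW _ _ _ _ 0%N); rewrite ?muln1 ?mulr1. Qed.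

Lemma puiseux_eqS n k (f g : puiseux K) : psupp n k f -> psupp n k g ->
  (forall m, f (pexp n k m) = g (pexp n k m)) -> f = g.
Proof.
move=> Hf Hg H; apply: puiseux_eq => q.
have [/eqP fq|/Hf[m ->]//] := boolP (f q == 0).
by have [/eqP gq|/Hg[m ->]//] := boolP (g q == 0); rewrite fq gq.
Qed.

Lemma pval_exists (f : puiseux K) : (exists q, f q != 0) ->
  exists q, f q != 0 /\ forall p, f p != 0 -> q <= p.
Proof.
case: (pcoefP f) => n [k Hf] [q fq].
have exm : exists m, f (pexp n k m) != 0.
  by case: (Hf _ fq) => m Em; exists m; rewrite -Em.
exists (pexp n k (ex_minn exm)); case: ex_minnP => m fm m_min; split=> // p fp.
case: (Hf _ fp) => j Ej; rewrite Ej pexp_le; apply: m_min.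
by rewrite -Ej.
Qed.

(* The exponent of the leading term (junk value 0 at the zero series). *)
Definition pval (f : puiseux K) : rat :=
  xget 0 [set q | f q != 0 /\ forall p, f p != 0 -> q <= p].

Definition plead (f : puiseux K) : K := f (pval f).

Lemma pvalP (f : puiseux K) : (exists q, f q != 0) ->
  f (pval f) != 0 /\ forall p, f p != 0 -> pval f <= p.
Proof.
move=> /pval_exists; rewrite /pval => H.
by case: xgetP => [q _ //|NP]; case: H => q /NP.
Qed.

End PuiseuxSupport.

Section PuiseuxZmodule.
Variable K : zmodType.
Implicit Types f g : puiseux K.

HB.instance Definition _ := gen_eqMixin (puiseux K).
HB.instance Definition _ := gen_choiceMixin (puiseux K).

Lemma padd_subproof f g : exists n k, psupp n k (fun q => f q + g q).
Proof.
have [n [k [Hf Hg]]] := psupp_common f g; exists n, k => q.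
have [/eqP ->|fq _] := boolP (f q == 0); last exact: Hf.
by rewrite add0r; apply: Hg.
Qed.
Definition padd f g := Puiseux (padd_subproof f g).

Lemma popp_subproof f : exists n k, psupp n k (fun q => - f q).
Proof.
by have [n [k Hf]] := pcoefP f; exists n, k => q; rewrite oppr_eq0; apply: Hf.
Qed.
Definition popp f := Puiseux (popp_subproof f).

Lemma pzero_subproof : exists n k, psupp n k (fun=> 0 : K).
Proof. by exists 0%N, 0 => q; rewrite eqxx. Qed.
Definition pzero := Puiseux pzero_subproof.

Fact paddA : associative padd.
Proof. by move=> f g h; apply: puiseux_eq => q /=; rewrite addrA. Qed.
Fact paddC : commutative padd.
Proof. by move=> f g; apply: puiseux_eq => q /=; rewrite addrC. Qed.
Fact padd0 : left_id pzero padd.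
Proof. by move=> f; apply: puiseux_eq => q /=; rewrite add0r. Qed.
Fact paddN : left_inverse pzero popp padd.
Proof. by move=> f; apply: puiseux_eq => q /=; rewrite addNr. Qed.

HB.instance Definition _ := GRing.isZmodule.Build (puiseux K)
  paddA paddC padd0 paddN.

Lemma puiseux_neq0P f : f != 0 <-> exists q, f q != 0.
Proof.
split=> [f0|[q fq]]; last by apply: contra_neq fq => ->.
apply: contrapT => /forallNP H; move/eqP: f0; apply; apply: puiseux_eq => q.
by have /negP := H q; rewrite negbK => /eqP.
Qed.

End PuiseuxZmodule.

Section PuiseuxRing.
Variable K : fieldType.
Implicit Types f g h : puiseux K.

Definition conv (a b : nat -> K) (m : nat) : K :=
  \sum_(i < m.+1) a i * b (m - i)%N.

Lemma conv_poly N a b m : (m < N)%N ->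
  conv a b m = (\poly_(i < N) a i * \poly_(i < N) b i)`_m.
Proof.
move=> mN; rewrite coefM; apply: eq_bigr => i _; rewrite !coef_poly.
have im : (i <= m)%N by rewrite -ltnS.
by rewrite (leq_ltn_trans im mN) (leq_ltn_trans (leq_subr i m) mN).
Qed.

Lemma convA a b c m : conv a (conv b c) m = conv (conv a b) c m.
Proof.
transitivity ((\poly_(i < m.+1) a i * \poly_(i < m.+1) b i
   * \poly_(i < m.+1) c i)`_m).
  rewrite -mulrA coefM; apply: eq_bigr => i _; rewrite coef_poly ltn_ord.
  by rewrite (@conv_poly m.+1) // ltnS leq_subr.
rewrite coefM; apply: eq_bigr => i _.
by rewrite [in RHS](@conv_poly m.+1) // coef_poly ltnS leq_subr.
Qed.

Lemma convC a b m : conv a b m = conv b a m.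
Proof. by rewrite !(@conv_poly m.+1) // mulrC. Qed.

Lemma conv1 b m : conv (fun i => (i == 0%N)%:R) b m = b m.
Proof.
rewrite /conv big_ord_recl /= mul1r subn0 big1 ?addr0 // => i _.
by rewrite mul0r.
Qed.

Lemma convDl a b c m :
  conv (fun i => a i + b i) c m = conv a c m + conv b c m.
Proof. by rewrite -big_split; apply: eq_bigr => i _; rewrite mulrDl. Qed.

Lemma eq_conv a a' b b' : a =1 a' -> b =1 b' -> conv a b =1 conv a' b'.
Proof. by move=> Ea Eb m; apply: eq_bigr => i _; rewrite Ea Eb. Qed.

Lemma conv_inv a : a 0%N != 0 ->
  exists b, forall m, conv a b m = (m == 0%N)%:R.
Proof.
move=> a0; pose next s := - (a 0%N)^-1 *
  \sum_(i < size s) a (size s - i)%N * s`_i.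
pose S N := iter N (fun s => rcons s (next s)) [:: (a 0%N)^-1].
have sS N : size (S N) = N.+1 by elim: N => //= N IH; rewrite size_rcons IH.
have SE N i : (i <= N)%N -> (S N)`_i = (S i)`_i.
  elim: N => [|N IH]; first by rewrite leqn0 => /eqP ->.
  rewrite leq_eqVlt => /predU1P[-> //|iN]; rewrite -IH //=.
  by rewrite nth_rcons sS iN.
exists (fun m => (S m)`_m) => -[|m]; first by rewrite /conv big_ord1 /= divff.
rewrite convC /conv big_ord_recr /= subnn nth_rcons sS ltnn eqxx /next sS.
rewrite mulrAC mulNr mulVf // mulN1r; apply/eqP; rewrite subr_eq0; apply/eqP.
by apply: eq_bigr => i _; rewrite mulrC (SE m) // -ltnS.
Qed.

(* The Cauchy product; all but finitely many terms of the sum are zero. *)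
Definition pmul_coef (f g : rat -> K) (q : rat) : K :=
  \sum_(p \in [set: rat]) f p * g (q - p).

Lemma pmul_supp n k l (f g : rat -> K) :
  psupp n k f -> psupp n l g -> psupp n (k + l) (pmul_coef f g).
Proof.
move=> Hf Hg q; apply: contra_neqP => H; apply: fsbig1 => p _.
apply/eqP; apply: contrapT => /negP; rewrite mulf_eq0 negb_or => /andP[].
move=> /Hf[i Ei] /Hg[j Ej]; apply: H; exists (i + j)%N.
by rewrite -pexpD -Ei -Ej addrC subrK.
Qed.

Lemma pmul_coefE n k l (f g : rat -> K) : psupp n k f -> psupp n l g ->
  forall m, pmul_coef f g (pexp n (k + l) m) =
            conv (f \o pexp n k) (g \o pexp n l) m.
Proof.
move=> Hf Hg m; pose s := [seq pexp n k i | i <- iota 0 m.+1].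
have us : uniq s by rewrite map_inj_uniq ?iota_uniq //; apply: pexp_inj.
rewrite /pmul_coef -(@fsbig_widen _ _ _ _ [set` s]) //.
  rewrite -fsbig_seq // big_map -/(index_iota 0 m.+1) big_mkord.
  apply: eq_bigr => i _ /=; congr (_ * g _); apply/eqP; rewrite subr_eq.
  by rewrite pexpD subnK -1?ltnS // [l + k]addrC.
move=> p [_ /= ps]; apply/eqP; apply: contrapT => /negP.
rewrite mulf_eq0 negb_or => /andP[/Hf[i Ei] /Hg[j Ej]]; apply: ps.
rewrite Ei map_f // mem_iota /= add0n ltnS.
have /pexp_inj -> : pexp n (k + l) m = pexp n (k + l) (i + j).
  by rewrite -pexpD -Ei -Ej [RHS]addrC subrK.
exact: leq_addr.
Qed.

Lemma pmul_subproof f g : exists n k, psupp n k (pmul_coef f g).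
Proof.
have [n [k [Hf Hg]]] := psupp_common f g.
by exists n, (k + k); apply: pmul_supp.
Qed.
Definition pmul f g := Puiseux (pmul_subproof f g).

Lemma pone_supp n : psupp n 0 (fun q => (q == 0)%:R : K).
Proof.
move=> q; have [-> _|] := eqVneq q 0; last by rewrite eqxx.
by exists 0%N; rewrite /pexp mul0r.
Qed.
Definition pone := Puiseux
  (ex_intro _ 0%N (ex_intro _ (0 : int) (@pone_supp 0))).

Lemma psupp_common3 f g h :
  exists n k, [/\ psupp n k f, psupp n k g & psupp n k h].
Proof.
have [n [k [Hf Hg]]] := psupp_common f g; have [n' [k' Hh]] := pcoefP h.
exists (n.+1 * n'.+1).-1, (Num.min (k * n'.+1%:Z) (k' * n.+1%:Z)).
by split; [apply: psuppW Hf | apply: psuppW Hg | apply: psuppW Hh];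
  rewrite ?prednK ?muln_gt0 // 1?mulnC // ge_min lexx ?orbT.
Qed.

Fact pmulA : associative pmul.
Proof.
move=> f g h; have [n [k [Hf Hg Hh]]] := psupp_common3 f g h.
have Hgh := pmul_supp Hg Hh; have Hfg := pmul_supp Hf Hg.
apply: (@puiseux_eqS _ n (k + (k + k))) => [||m].
- exact: pmul_supp.
- by rewrite addrA; apply: pmul_supp.
rewrite /= (pmul_coefE Hf Hgh) addrA (pmul_coefE Hfg Hh).
rewrite (eq_conv (fun=> erefl) (pmul_coefE Hg Hh)).
by rewrite [RHS](eq_conv (pmul_coefE Hf Hg) (fun=> erefl)) convA.
Qed.

Fact pmulC : commutative pmul.
Proof.
move=> f g; have [n [k [Hf Hg]]] := psupp_common f g.
apply: (@puiseux_eqS _ n (k + k)) => [||m]; try exact: pmul_supp.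
by rewrite /= (pmul_coefE Hf Hg) (pmul_coefE Hg Hf) convC.
Qed.

Fact pmul1 : left_id pone pmul.
Proof.
move=> f; have [n [k Hf]] := pcoefP f.
have H1f := pmul_supp (@pone_supp n) Hf.
apply: (@puiseux_eqS _ n (0 + k)) => [//||m]; first by rewrite add0r.
rewrite /= (pmul_coefE (@pone_supp n) Hf) add0r -[RHS](conv1 (f \o pexp n k)).
apply: eq_conv => // i /=.
by rewrite -(inj_eq (@pexp_inj n 0)) [pexp n 0 0]mul0r.
Qed.

Fact pmulDl : left_distributive pmul +%R.
Proof.
move=> f g h; have [n [k [Hf Hg Hh]]] := psupp_common3 f g h.
have Hfg : psupp n k (f + g : puiseux K).
  move=> q; have [/eqP fq|fq _] := boolP (f q == 0); last exact: Hf.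
  by rewrite /= fq add0r; apply: Hg.
apply: (@puiseux_eqS _ n (k + k)) => [|q|m] /=; first exact: pmul_supp.
  have [/eqP ->|fhq _] := boolP (pmul_coef f h q == 0).
    by rewrite add0r; apply: (pmul_supp Hg Hh).
  exact: (pmul_supp Hf Hh).
by rewrite (pmul_coefE Hfg Hh) (pmul_coefE Hf Hh) (pmul_coefE Hg Hh) -convDl.
Qed.

Fact pone_neq0 : pone != 0.
Proof. by apply/puiseux_neq0P; exists 0; rewrite /= oner_neq0. Qed.

HB.instance Definition _ := GRing.Zmodule_isComNzRing.Build (puiseux K)
  pmulA pmulC pmul1 pmulDl pone_neq0.

Lemma pinv_exists f : f != 0 -> exists g, g * f = 1.
Proof.
move=> /puiseux_neq0P f0; have [n [k0 Hf0]] := pcoefP f.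
have [fv v_min] := pvalP f0; have [m0 Em0] := Hf0 _ fv.
pose k := k0 + m0%:Z; have Ev : pval f = pexp n k 0 by rewrite Em0 /pexp addr0.
have Hf : psupp n k f.
  move=> q fq; have [m Em] := Hf0 _ fq; have := v_min _ fq.
  rewrite Em0 Em pexp_le => m0m; exists (m - m0)%N.
  by rewrite /pexp -addrA -PoszD subnKC.
have [|b Hb] := @conv_inv (f \o pexp n k); first by rewrite /= -Ev.
pose g q := if pselect (exists m, q = pexp n (- k) m) is left e
            then b (projT1 (cid e)) else 0.
have Hg : psupp n (- k) g.
  by move=> q; rewrite /g; case: pselect => // _; rewrite eqxx.
have gE m : g (pexp n (- k) m) = b m.
  rewrite /g; case: pselect => [e|[]]; last by exists m.
  by case: cid => j /= /pexp_inj ->.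
exists (Puiseux (ex_intro _ n (ex_intro _ (- k) Hg))); rewrite [LHS]mulrC.
have Hfg := pmul_supp Hf Hg.
apply: (@puiseux_eqS _ n (k - k)) => [//||m].
  by rewrite subrr; apply: pone_supp.
rewrite [LHS](pmul_coefE Hf Hg) (eq_conv (fun=> erefl) gE) Hb subrr /=.
by rewrite -(inj_eq (@pexp_inj n 0)) [pexp n 0 0]mul0r.
Qed.

Definition pinv f : puiseux K := xget 0 [set g | g * f = 1].

Fact pmulV f : f != 0 -> pinv f * f = 1.
Proof.
move=> /pinv_exists[g gf]; rewrite /pinv; by case: xgetP => [h _ //|/(_ g)].
Qed.

Fact pinv0 : pinv 0 = 0.
Proof.
rewrite /pinv; case: xgetP => // h _ /= /eqP.
by rewrite mulr0 eq_sym oner_eq0.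
Qed.

HB.instance Definition _ := GRing.ComNzRing_isField.Build (puiseux K)
  pmulV pinv0.

End PuiseuxRing.

Lemma pmap_subproof (K L : nmodType) (h : {additive K -> L})
  (f : puiseux K) : exists n k, psupp n k (h \o f).
Proof.
have [n [k Hf]] := pcoefP f; exists n, k => q /= hfq; apply: Hf.
by apply: contra_neq hfq => ->; rewrite raddf0.
Qed.
Definition pmap (K L : nmodType) (h : {additive K -> L}) (f : puiseux K) :
  puiseux L := Puiseux (pmap_subproof h f).

Definition positive_puiseux (K : numFieldType) : set (puiseux K) :=
  [set f | 0 < plead f].

Section Tropicalization.
Variable R : realType.

(* The order of R[i] is such that 0 < z means that z is a positive real. *)
Definition Cplus : set (puiseux R[i]) := @positive_puiseux R[i].

(* The real Puiseux series are identified with their image in the field of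
   complex Puiseux series. *)
Definition Rplus : set (puiseux R[i]) :=
  [set pmap (real_complex R) f | f in @positive_puiseux R].

Definition trop (P : set (puiseux R[i])) (d n : nat)
    (X : set 'M[puiseux R[i]]_(d, n)) : set 'M[R]_(d, n) :=
  closure [set map_mx (fun f => ratr (pval f) : R) x
          | x in X `&` [set x | forall i j, P (x i j)]].

Definition rank_le (r d n : nat) : set 'M[puiseux R[i]]_(d, n) :=
  [set x | (\rank x <= r)%N].

(* The tropical product of two real matrices.  The value +oo of an empty
   minimum is not in R, so a real matrix with at least one entry is never a
   product with inner dimension r = 0. *)
Definition tropmul (d r n : nat) (B : 'M[R]_(d, r)) (C : 'M[R]_(r, n)) :
    'M[\bar R]_(d, n) :=
  \matrix_(i, j) \big[Order.min/+oo%E]_(k < r) (B i k + C k j)%:E.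

Definition tropical_factor (d n : nat) (A : 'M[R]_(d, n)) (r : nat) : Prop :=
  exists (B : 'M[R]_(d, r)) (C : 'M[R]_(r, n)), map_mx EFin A = tropmul B C.

Lemma tropical_factor_exists d n (A : 'M[R]_(d, n)) :
  exists r, `[< tropical_factor A r >].
Proof.
exists d; apply/asboolP; pose L := \sum_i \sum_j `|A i j|.
have AL i j : `|A i j| <= L.
  rewrite /L (bigD1 i) //= (bigD1 j) //= -addrA lerDl.
  rewrite addr_ge0 // ?sumr_ge0 // => k _; exact: sumr_ge0.
exists (\matrix_(i, k) if i == k then 0 else L + L), A.
apply/matrixP => i j; rewrite !mxE.
apply/le_anti/andP; split.
  apply/bigmin_geP; split=> [|k _]; first exact: leey.
  rewrite lee_fin mxE; case: eqP => [->|_]; first by rewrite add0r.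
  rewrite -lerBlDr; apply: (le_trans _ (lerD (AL i j) (AL k j))).
  by apply: lerD; [exact: ler_norm | rewrite -normrN ler_norm].
by apply: (@bigmin_inf _ _ _ _ i) => //; rewrite mxE eqxx add0r.
Qed.

Definition barvinok_rank (d n : nat) (A : 'M[R]_(d, n)) : nat :=
  ex_minn (tropical_factor_exists A).

End Tropicalization.

(* Main.v *)
(* If a matrix x over the complex Puiseux series has rank at most 2 and
   positive leading coefficients, its 3x3 minors vanish.  A sum of series with
   positive leading coefficients has no cancellation of leading terms, so
   moving the odd terms of a minor to the other side shows that the even and
   the odd terms of each tropical 3x3 minor of val x have the same minimum.
   This condition is closed, and it implies tropical rank-2 factorization:
   each 3x3 submatrix has one column on the tropical segment spanned by the
   other two; if this holds for all triples of columns, then all columns lie on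
   one tropical segment, since a segment may be extended point by point.
   Applying this to 3 x n submatrices, and then, after transposing, to the
   whole matrix, gives Barvinok rank at most 2.  Conversely a factorization
   with rational entries lifts, by replacing each entry q by t^q, to real
   series, and real factorizations are limits of rational ones. *)
Require Import Defs.
From mathcomp Require Import all_boot all_order all_algebra.
From mathcomp Require Import all_classical all_reals all_analysis.
From mathcomp Require Import complex ring lra.

Set Implicit Arguments.
Unset Strict Implicit.
Unset Printing Implicit Defensive.

Import Order.TTheory GRing.Theory Num.Theory.
Import numFieldNormedType.Exports.

Local Open Scope classical_set_scope.
Local Open Scope ring_scope.

(** * Tropical segments and collinear triples *)

Section TropicalSegments.
Variable R : realFieldType.

Definition trop_segment (I : Type) (u v w : I -> R) : Prop :=
  exists a b, forall i, w i = Num.min (u i + a) (v i + b).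

Definition trop_collinear (I : Type) (p q r : I -> R) : Prop :=
  [\/ trop_segment q r p, trop_segment p r q | trop_segment p q r].

Definition trop_rank2 (I J : Type) (A : I -> J -> R) : Prop :=
  exists (u v : I -> R) (a b : J -> R),
    forall i j, A i j = Num.min (u i + a j) (v i + b j).

Lemma trop_segmentC (I : Type) (u v w : I -> R) :
  trop_segment u v w -> trop_segment v u w.
Proof. by move=> [a [b H]]; exists b, a => i; rewrite H minC. Qed.

Lemma trop_segment_trans (I : Type) (u v w x : I -> R) :
  trop_segment u w v -> trop_segment u v x -> trop_segment u w x.
Proof.
move=> [c [e Hv]] [a [b Hx]]; exists (Num.min a (c + b)), (e + b) => i.
by rewrite Hx Hv addr_minl addr_minr !addrA minA.
Qed.

Lemma trop_collinear_mid (I : Type) (e f p q r : I -> R)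
    (a1 a2 a3 b1 b2 b3 : R) :
  (forall i, p i = Num.min (e i + a1) (f i + b1)) ->
  (forall i, q i = Num.min (e i + a2) (f i + b2)) ->
  (forall i, r i = Num.min (e i + a3) (f i + b3)) ->
  b1 - a1 <= b2 - a2 -> b2 - a2 <= b3 - a3 -> trop_segment p r q.
Proof.
(* The shifts match the [f]-term of [q] with that of [p] and the [e]-term with that of [r]; the
   order of the differences [b - a] keeps the other two terms from being smaller. *)
move=> Hp Hq Hr le12 le23; exists (b2 - b1), (a2 - a3) => i.
rewrite Hp Hq Hr.
case: (leP (e i + a1)) => ?; case: (leP (e i + a2)) => ?;
  case: (leP (e i + a3)) => ?; case: leP => ?; lra.
Qed.

Lemma trop_segment_collinear (I : Type) (e f p q r : I -> R) :
  trop_segment e f p -> trop_segment e f q -> trop_segment e f r ->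
  trop_collinear p q r.
Proof.
move=> [a1 [b1 Hp]] [a2 [b2 Hq]] [a3 [b3 Hr]].
(* Sort the three values of [b - a]; the point with the middle value lies between the others. *)
have [?|/ltW ?] := leP (b1 - a1) (b2 - a2);
have [?|/ltW ?] := leP (b2 - a2) (b3 - a3);
have [?|/ltW ?] := leP (b1 - a1) (b3 - a3).
- by apply: Or32; apply: (trop_collinear_mid Hp Hq Hr).
- by apply: Or32; apply: (trop_collinear_mid Hp Hq Hr).
- by apply: Or33; apply: (trop_collinear_mid Hp Hr Hq).
- by apply: Or31; apply/trop_segmentC/(trop_collinear_mid Hr Hp Hq).
- by apply: Or31; apply: (trop_collinear_mid Hq Hp Hr).
- by apply: Or33; apply/trop_segmentC/(trop_collinear_mid Hq Hr Hp).
- by apply: Or32; apply/trop_segmentC/(trop_collinear_mid Hr Hq Hp).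
- by apply: Or32; apply/trop_segmentC/(trop_collinear_mid Hr Hq Hp).
Qed.

Lemma trop_rank2_collinear (I J : Type) (A : I -> J -> R) i1 i2 i3 :
  trop_rank2 A -> trop_collinear (A i1) (A i2) (A i3).
Proof.
move=> [u [v [a [b H]]]]; apply: (@trop_segment_collinear _ a b).
- by exists (u i1), (v i1) => j; rewrite H [u _ + _]addrC [v _ + _]addrC.
- by exists (u i2), (v i2) => j; rewrite H [u _ + _]addrC [v _ + _]addrC.
- by exists (u i3), (v i3) => j; rewrite H [u _ + _]addrC [v _ + _]addrC.
Qed.

Lemma trop_collinear_end (I : Type) (u w : I -> R) :
  trop_collinear u w w -> trop_segment u w w.
Proof.
(* Here [u] is [w] shifted by [Num.min a b]; shifting back recovers [w]. *)
case=> // -[a [b Hu]]; exists (- Num.min a b), 0 => i.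
by rewrite Hu -addr_minr addrK addr0 minxx.
Qed.

(** The induction keeps both endpoints inside the family, so collinearity applies to them and the
    next point, which either lies between them or replaces one of them. *)
Lemma collinear_segment (I : Type) (J : eqType) (A : J -> I -> R) :
  (forall j1 j2 j3, trop_collinear (A j1) (A j2) (A j3)) ->
  forall j0 (s : seq J), exists u v,
  forall j, j \in j0 :: s -> trop_segment (A u) (A v) (A j).
Proof.
move=> colA j0; elim=> [|k s [u [v IH]]].
  by exists j0, j0 => j; rewrite inE => /eqP ->; case: (colA j0 j0 j0).
have ext w x : (forall j, j \in j0 :: s -> trop_segment (A w) (A x) (A j)) ->
    trop_segment (A w) (A k) (A x) ->
  exists u v, forall j, j \in [:: j0, k & s] -> trop_segment (A u) (A v) (A j).
  move=> H wkx; exists w, k => j; rewrite !inE orbCA => /predU1P[->|js].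
    exact: trop_collinear_end.
  by apply: trop_segment_trans wkx _; apply: H; rewrite inE.
have [vku|ukv|uvk] := colA u v k.
- by apply: (ext v u) => // j /IH /trop_segmentC.
- exact: (ext u v).
- exists u, v => j; rewrite !inE orbCA => /predU1P[->//|js].
  by apply: IH; rewrite inE.
Qed.

Lemma collinear_trop_rank2 (I : Type) (J : finType) (A : I -> J -> R) :
  J -> (forall j1 j2 j3, trop_collinear (A^~ j1) (A^~ j2) (A^~ j3)) ->
  trop_rank2 A.
Proof.
move=> j0 colA.
have [u [v H]] := @collinear_segment I J (fun j i => A i j) colA j0 (enum J).
have {}H j : exists ab, forall i, A i j = Num.min (A i u + ab.1) (A i v + ab.2).
  have [|a [b Hab]] := H j; first by rewrite inE mem_enum orbT.
  by exists (a, b).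
have [ab Hab] := choice H.
by exists (A^~ u), (A^~ v), (fun j => (ab j).1), (fun j => (ab j).2).
Qed.

Lemma trop_rank2_tr (I J : Type) (A : I -> J -> R) :
  trop_rank2 (fun j i => A i j) -> trop_rank2 A.
Proof.
move=> [u [v [a [b H]]]]; exists a, b, u, v => i j.
by rewrite H [u _ + _]addrC [v _ + _]addrC.
Qed.

(** * From balanced 3x3 minors to tropical rank 2 *)

Lemma trop_collinearC (I : Type) (p q r : I -> R) :
  trop_collinear p q r -> trop_collinear q p r.
Proof.
by case=> [?|?|/trop_segmentC ?]; [apply: Or32 | apply: Or31 | apply: Or33].
Qed.

Lemma trop_collinearCr (I : Type) (p q r : I -> R) :
  trop_collinear p q r -> trop_collinear p r q.
Proof.
by case=> [/trop_segmentC ?|?|?]; [apply: Or31 | apply: Or33 | apply: Or32].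
Qed.

(** The even half of the tropical 3x3 determinant with columns [p], [q], [r]. *)
Definition cyclic_min (I : Type) (p q r : I -> R) i1 i2 i3 : R :=
  Num.min (p i1 + q i2 + r i3)
    (Num.min (q i1 + r i2 + p i3) (r i1 + p i2 + q i3)).

(* Swapping the last two columns exchanges the even and the odd terms of the
   tropical 3x3 determinant. *)
Definition balanced_minors (I J : Type) (A : I -> J -> R) : Prop :=
  forall i1 i2 i3 j1 j2 j3,
  cyclic_min (A^~ j1) (A^~ j2) (A^~ j3) i1 i2 i3 =
  cyclic_min (A^~ j1) (A^~ j3) (A^~ j2) i1 i2 i3.

(* An even and an odd permutation of three elements agree at exactly one point;
   here that common entry of the two minimal terms is r i3. *)
Lemma minor3_collinear (I : Type) (p q r : I -> R) i1 i2 i3 :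
  (forall i, [\/ i = i1, i = i2 | i = i3]) ->
  p i1 + q i2 + r i3 = q i1 + p i2 + r i3 ->
  p i1 + q i2 + r i3 <= p i1 + r i2 + q i3 ->
  p i1 + q i2 + r i3 <= r i1 + p i2 + q i3 ->
  p i1 + q i2 + r i3 <= q i1 + r i2 + p i3 ->
  p i1 + q i2 + r i3 <= r i1 + q i2 + p i3 ->
  trop_collinear p q r.
Proof.
move=> Icover E le1 le2 le3 le4.
(* [E] makes [p - q] equal at [i1] and [i2], so one of [p], [q] matches a shift of the other there
   and a shift of [r] at [i3]; the comparison decides which one. *)
have [le|/ltW le] := leP (p i3 - p i1) (q i3 - q i1); [apply: Or31|apply: Or32].
  exists (p i1 - q i1), (p i3 - r i3) => i.
  by case: (Icover i) => ->; case: leP => ?; lra.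
exists (q i1 - p i1), (q i3 - r i3) => i.
by case: (Icover i) => ->; case: leP => ?; lra.
Qed.

Lemma cyclic_minP (I : Type) (p q r : I -> R) i1 i2 i3 :
  let m := cyclic_min p q r i1 i2 i3 in
  [/\ m <= p i1 + q i2 + r i3, m <= q i1 + r i2 + p i3,
    m <= r i1 + p i2 + q i3 &
    [\/ m = p i1 + q i2 + r i3, m = q i1 + r i2 + p i3 |
        m = r i1 + p i2 + q i3]].
Proof.
rewrite /cyclic_min; case: (leP (q i1 + r i2 + p i3)) => ?;
  case: (leP (p i1 + q i2 + r i3)) => ?; split; try lra;
  by [apply: Or31 | apply: Or32 | apply: Or33].
Qed.

Lemma balanced_collinear (I : Type) (p q r : I -> R) i1 i2 i3 :
  (forall i, [\/ i = i1, i = i2 | i = i3]) ->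
  cyclic_min p q r i1 i2 i3 = cyclic_min p r q i1 i2 i3 ->
  trop_collinear p q r.
Proof.
move=> I123.
have I132 i : [\/ i = i1, i = i3 | i = i2].
  by case: (I123 i) => ->; [apply: Or31 | apply: Or33 | apply: Or32].
have I231 i : [\/ i = i2, i = i3 | i = i1].
  by case: (I123 i) => ->; [apply: Or33 | apply: Or31 | apply: Or32].
have [e1 e2 e3 e_eq] := cyclic_minP p q r i1 i2 i3.
have [f1 f2 f3 f_eq] := cyclic_minP p r q i1 i2 i3.
(* In each of the nine cases the row and the column of the entry shared by the two minimal terms are
   moved to the last place. *)
move=> Eef; case: e_eq => Ee; case: f_eq => Ef.
- apply/trop_collinearC/trop_collinearCr/trop_collinearC.
  by apply: (minor3_collinear I231); lra.
- by apply: trop_collinearCr; apply: (minor3_collinear I132); lra.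
- by apply: (minor3_collinear I123); lra.
- by apply: trop_collinearC; apply: (minor3_collinear I132); lra.
- apply/trop_collinearC/trop_collinearCr.
  by apply: (minor3_collinear I123); lra.
- apply/trop_collinearCr/trop_collinearC.
  by apply: (minor3_collinear I231); lra.
- apply/trop_collinearCr/trop_collinearC.
  by apply: (minor3_collinear I123); lra.
- by apply: (minor3_collinear I231); lra.
- apply/trop_collinearC/trop_collinearCr/trop_collinearC.
  by apply: (minor3_collinear I132); lra.
Qed.

(** [balanced_collinear] covers only three rows. Rank 2 of a three-row submatrix makes its full rows
    collinear, which is the input of the second pass. *)
Lemma balanced_trop_rank2 (I J : finType) (A : I -> J -> R) :
  I -> J -> balanced_minors A -> trop_rank2 A.
Proof.
move=> i0 j0 balA; apply: trop_rank2_tr.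
apply: (collinear_trop_rank2 i0) => i1 i2 i3.
pose row (k : 'I_3) := nth i1 [:: i1; i2; i3] k.
have rk2 : trop_rank2 (fun k => A (row k)).
  apply: (collinear_trop_rank2 j0) => j1 j2 j3.
  apply: (@balanced_collinear _ _ _ _ 0 1 2%:R) (balA _ _ _ _ _ _).
  by case=> -[|[|[|//]]] lt3; [apply: Or31 | apply: Or32 | apply: Or33];
    apply: val_inj.
exact: (trop_rank2_collinear 0 1 2%:R rk2).
Qed.

End TropicalSegments.

(** * Series with positive leading coefficient *)

Section PositiveLeading.
Variable K : numFieldType.
Implicit Types f g : puiseux K.

(** Taking the exponent as an argument lets sums and products be treated without the chosen value
    [pval]. *)
Definition pos_at f (q : rat) : Prop := 0 < f q /\ forall p, f p != 0 -> q <= p.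

Lemma pos_at_pval f q : pos_at f q -> pval f = q.
Proof.
move=> [fq min_q]; have nz : exists q, f q != 0 by exists q; rewrite gt_eqF.
have [fv min_v] := pvalP nz.
by apply/le_anti; rewrite min_q // min_v // gt_eqF.
Qed.

Lemma pos_at_uniq f q p : pos_at f q -> pos_at f p -> q = p.
Proof. by move=> /pos_at_pval <- /pos_at_pval. Qed.

Lemma pos_at_positive f q : pos_at f q -> positive_puiseux f.
Proof.
by move=> fq; rewrite /positive_puiseux /= /plead (pos_at_pval fq); case: fq.
Qed.

Lemma positive_pos_at f : positive_puiseux f -> pos_at f (pval f).
Proof.
move=> f0; split=> //; apply: (proj2 (pvalP _)); exists (pval f).
by rewrite gt_eqF.
Qed.

Lemma pos_at_lt f q p : pos_at f q -> p < q -> f p = 0.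
Proof.
move=> [_ min_q] pq; apply/eqP; apply: contraT => /min_q.
by rewrite leNgt pq.
Qed.

(** Cancellation could occur only for [q = p], where both leading coefficients are positive. *)
Lemma pos_atD f g q p : pos_at f q -> pos_at g p ->
  pos_at (f + g) (Num.min q p).
Proof.
move=> fq gp; split=> [|x /=].
  have [qp|pq|Eqp] /= := ltgtP q p.
  - by rewrite (pos_at_lt gp qp) addr0; case: fq.
  - by rewrite (pos_at_lt fq pq) add0r; case: gp.
  - case: fq gp; rewrite Eqp => fp _ [gp _]; exact: addr_gt0.
apply: contraNT; rewrite -ltNge lt_min => /andP[xq xp].
by rewrite (pos_at_lt fq xq) (pos_at_lt gp xp) addr0.
Qed.

Lemma pos_atM f g q p : pos_at f q -> pos_at g p -> pos_at (f * g) (q + p).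
Proof.
move=> fq gp; split=> [|x].
  have -> : (f * g : puiseux K) (q + p) = f q * g p.
    rewrite [LHS](_ : _ = pmul_coef f g (q + p)) // /pmul_coef.
    (* Only the index [q] survives: below it [f] vanishes, above it the factor from [g] does. *)
    rewrite -(@fsbig_widen _ _ _ _ [set q]) //.
      by rewrite fsbig_set1 addrC addKr.
    move=> y [_ /= /eqP yq]; apply/eqP; rewrite mulf_eq0.
    have [yltq|] := ltP y q; first by rewrite (pos_at_lt fq yltq) eqxx.
    rewrite le_eqVlt eq_sym (negPf yq) /= => qy.
    by rewrite (pos_at_lt gp) ?eqxx ?orbT // ltrBlDr addrC ltrD2l.
  by case: fq gp => fq0 _ [gp0 _]; rewrite mulr_gt0.
apply: contraNT; rewrite -ltNge => xqp.
rewrite [X in X == _](_ : _ = pmul_coef f g x) // /pmul_coef fsbig1 // => y _.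
have [yltq|qy] := ltP y q; first by rewrite (pos_at_lt fq yltq) mul0r.
rewrite (pos_at_lt gp) ?mulr0 // ltrBlDr (lt_le_trans xqp) //.
by rewrite addrC lerD2l.
Qed.

Lemma monomial_subproof (q : rat) :
  exists n k, psupp n k (fun p => (p == q)%:R : K).
Proof.
(* [psupp] takes [n.+1] as denominator, hence the predecessor. *)
exists `|denq q|.-1%N, (numq q) => p.
have [-> _|] := eqVneq p q; last by rewrite eqxx.
exists 0%N; rewrite /pexp addr0 prednK ?absz_gt0 ?denq_eq0 //.
by rewrite -[in LHS](divq_num_den q) -[in LHS](absz_denq q).
Qed.
Definition monomial (q : rat) : puiseux K := Puiseux (monomial_subproof q).

Lemma pos_at_monomial q : pos_at (monomial q) q.
Proof.
split=> [|p] /=; first by rewrite eqxx.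
by have [->//|] := eqVneq p q; rewrite eqxx.
Qed.

Lemma monomialD q p : monomial (q + p) = monomial q * monomial p.
Proof.
apply: puiseux_eq => x.
rewrite [RHS](_ : _ = pmul_coef (monomial q) (monomial p) x) //.
rewrite /pmul_coef -(@fsbig_widen _ _ _ _ [set q]) //.
  by rewrite fsbig_set1 /= eqxx mul1r subr_eq [p + q]addrC.
by move=> y [_ /= /eqP /negPf ->]; rewrite mul0r.
Qed.

End PositiveLeading.

Lemma pos_at_pmap (R : realType) (f : puiseux R) q :
  pos_at f q -> pos_at (Defs.pmap (real_complex R) f) q.
Proof.
move=> [fq min_q]; split=> [|p /=]; first by rewrite /= ltcR.
move=> H; apply: min_q; apply: contra_neq H => ->; by rewrite raddf0.
Qed.

(** * Vanishing 3x3 minors and their limits *)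

(** Even and odd terms are grouped as in [cyclic_min], so that [pos_atD] and [pos_atM] reproduce
    that minimum. *)
Lemma det_mxsub3 (K : comPzRingType) (m n : nat) (A : 'M[K]_(m, n))
    i1 i2 i3 j1 j2 j3 :
  \det (mxsub (fun i : 'I_3 => nth i1 [:: i1; i2; i3] i)
              (fun j : 'I_3 => nth j1 [:: j1; j2; j3] j) A) =
  A i1 j1 * A i2 j2 * A i3 j3 +
    (A i1 j2 * A i2 j3 * A i3 j1 + A i1 j3 * A i2 j1 * A i3 j2) -
  (A i1 j1 * A i2 j3 * A i3 j2 +
    (A i1 j3 * A i2 j2 * A i3 j1 + A i1 j2 * A i2 j1 * A i3 j3)).
Proof.
rewrite (expand_det_row _ ord0) !big_ord_recl big_ord0 /cofactor.
rewrite !(expand_det_row _ ord0) !big_ord_recl !big_ord0 /cofactor !det_mx11.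
rewrite !mxE /= /bump /=; ring.
Qed.

Lemma rank2_det3 (K : fieldType) (m n : nat) (A : 'M[K]_(m, n))
    (f : 'I_3 -> 'I_m) (g : 'I_3 -> 'I_n) :
  (\rank A <= 2)%N -> \det (mxsub f g A) = 0.
Proof.
move=> rkA; apply/eqP; apply: contraTT rkA; rewrite -unitfE -unitmxE -ltnNge.
(* An invertible submatrix has rank 3, yet the rank factorization of [A] makes it a product with
   inner dimension [\rank A]. *)
rewrite -row_free_unit -{1}(mulmx_base A) mxsub_mul => /eqP <-.
exact: mulmx_max_rank.
Qed.

Lemma rank2_balanced (R : realType) (d n : nat) (x : 'M[puiseux R[i]]_(d, n)) :
  (\rank x <= 2)%N -> (forall i j, Cplus (x i j)) ->
  balanced_minors (fun i j => ratr (pval (x i j)) : R).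
Proof.
move=> rkx posx i1 i2 i3 j1 j2 j3.
have pos i j : pos_at (x i j) (pval (x i j)) by apply/positive_pos_at/posx.
have Edet := rank2_det3 (fun i => nth i1 [:: i1; i2; i3] i)
  (fun j => nth j1 [:: j1; j2; j3] j) rkx.
move: Edet; rewrite det_mxsub3 => /eqP; rewrite subr_eq0 => /eqP Eeo.
pose V i j := pval (x i j).
suff EV : cyclic_min (V^~ j1) (V^~ j2) (V^~ j3) i1 i2 i3 =
    cyclic_min (V^~ j1) (V^~ j3) (V^~ j2) i1 i2 i3.
  have := congr1 (ratr : rat -> R) EV.
  by rewrite /cyclic_min !minr_rat !rmorphD.
(* By [Eeo] the even and the odd sum are one series, whose valuation is read off twice. *)
apply: (@pos_at_uniq _ (x i1 j1 * x i2 j2 * x i3 j3 +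
    (x i1 j2 * x i2 j3 * x i3 j1 + x i1 j3 * x i2 j1 * x i3 j2))).
  by do !apply: pos_atD; do !apply: pos_atM.
by rewrite Eeo; do !apply: pos_atD; do !apply: pos_atM.
Qed.

(** Each balancing identity is the vanishing of a continuous function of the entries, hence a closed
    condition. *)
Lemma closure_balanced (R : realType) (d n : nat) (A : 'M[R]_(d, n)) :
  closure [set B : 'M[R]_(d, n) | balanced_minors (fun i j => B i j)] A ->
  balanced_minors (fun i j => A i j).
Proof.
move=> clA i1 i2 i3 j1 j2 j3.
pose F q1 q2 q3 (B : 'M[R]_(d, n)) :=
  cyclic_min (B^~ q1) (B^~ q2) (B^~ q3) i1 i2 i3.
have contF q1 q2 q3 : continuous (F q1 q2 q3).
  pose T l1 l2 l3 (B : 'M[R]_(d, n)) : R^o :=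
    B i1 l1 + B i2 l2 + B i3 l3.
  have contT l1 l2 l3 : continuous (T l1 l2 l3).
    have coord k l := @coord_continuous R d n k l.
    move=> B; apply: (@cvgD R R^o) (coord i3 l3 B).
    exact: (@cvgD R R^o _ _ _ _ _ _ _ (coord i1 l1 B) (coord i2 l2 B)).
  move=> B; rewrite [F _ _ _](_ : _ = T q1 q2 q3 \min
    (T q2 q3 q1 \min T q3 q1 q2)) //.
  exact: (@continuous_min R _ _ _ B (contT _ _ _ B)
    (@continuous_min R _ _ _ B (contT _ _ _ B) (contT _ _ _ B))).
have clF : closed [set B | F j1 j2 j3 B - F j1 j3 j2 B = 0].
  apply: (@preimage_closed _ R^o
    (fun B => F j1 j2 j3 B - F j1 j3 j2 B) [set 0]).
    move=> B _.
    exact: (@cvgB R R^o _ _ _ _ _ _ _ (contF _ _ _ B) (contF _ _ _ B)).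
  exact: closed_eq.
apply/eqP; rewrite -subr_eq0; apply/eqP.
suff : [set B | F j1 j2 j3 B - F j1 j3 j2 B = 0] A by [].
rewrite ((closure_id _).1 clF); apply: closure_subset clA => B balB /=.
by apply/eqP; rewrite subr_eq0; apply/eqP; apply: balB.
Qed.

(** * Barvinok rank and lifting to real series *)

Section Barvinok.
Variables (R : realType) (d n : nat).
Implicit Types A : 'M[R]_(d, n).

Lemma tropmul2E (B : 'M[R]_(d, 2)) (C : 'M[R]_(2, n)) i j :
  tropmul B C i j = (Num.min (B i 0 + C 0 j) (B i 1 + C 1 j))%:E.
Proof.
rewrite mxE !big_ord_recl big_ord0 [Order.min _ +oo%E]min_l ?leey // EFin_min.
by congr (Order.min (B i _ + C _ j)%:E (B i _ + C _ j)%:E); apply: val_inj.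
Qed.

Lemma tropical_factor2P A :
  tropical_factor A 2 <-> trop_rank2 (fun i j => A i j).
Proof.
split=> [[B [C /matrixP E]]|[u [v [a [b E]]]]].
  exists (B^~ 0), (B^~ 1), (C 0), (C 1) => i j.
  by have := E i j; rewrite tropmul2E mxE => -[].
exists (\matrix_(i, k) if k == 0 then u i else v i),
       (\matrix_(k, j) if k == 0 then a j else b j).
by apply/matrixP => i j; rewrite tropmul2E !mxE E.
Qed.

Lemma tropical_factor1W A : tropical_factor A 1 -> tropical_factor A 2.
Proof.
move=> [B [C /matrixP E]]; apply/tropical_factor2P.
exists (B^~ 0), (B^~ 0), (C 0), (C 0) => i j; rewrite minxx.
by have := E i j; rewrite !mxE big_ord1 => -[].
Qed.

Lemma barvinok_rank_le2 A (i0 : 'I_d) (j0 : 'I_n) :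
  (barvinok_rank A <= 2)%N <-> trop_rank2 (fun i j => A i j).
Proof.
rewrite -tropical_factor2P /barvinok_rank; case: ex_minnP => r /asboolP fA minr.
split=> [|/asboolP]; last exact: minr.
case: r fA {minr} => [|[|[|//]]] // fA _; last exact: tropical_factor1W.
(* For [r = 0] the entry at [i0], [j0] would be the empty minimum [+oo]. *)
by case: fA => B [C /matrixP/(_ i0 j0)]; rewrite !mxE big_ord0.
Qed.

Lemma trop_rank2_lift A :
  trop_rank2 (fun i j => A i j) -> trop (@Rplus R) (@rank_le R 2 d n) A.
Proof.
move=> [u [v [a [b E]]]] S /nbhs_ballP[e /= e0 eS].
(* Exponents must be rational; an error below [e / 2] in each summand gives one below [e] in each
   sum, and so in the minimum. *)
have approx T (f : T -> R) : exists g : T -> rat,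
    forall t, `|f t - ratr (g t)| < e / 2.
  suff /choice[g Hg] : forall t, exists q : rat, `|f t - ratr q| < e / 2.
    by exists g.
  move=> t; have [|q] := @rat_in_itvoo R (f t) (f t + e / 2); first by lra.
  rewrite in_itv /= => /andP[q1 q2]; exists q.
  by rewrite ltr_norml; apply/andP; split; lra.
have [u' Hu] := approx _ u; have [v' Hv] := approx _ v.
have [a' Ha] := approx _ a; have [b' Hb] := approx _ b.
pose U : 'M[puiseux R[i]]_(d, 2) :=
  \matrix_(i, k) monomial _ (if k == 0 then u' i else v' i).
pose V : 'M[puiseux R[i]]_(2, n) :=
  \matrix_(k, j) monomial _ (if k == 0 then a' j else b' j).
(* The inner dimension of [U *m V] bounds its rank by 2; [xE] shows its entries to be images of real
   series. *)
have xE i j : (U *m V) i j = Defs.pmap (real_complex R)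
    (monomial R (u' i + a' j) + monomial R (v' i + b' j)).
  rewrite mxE !big_ord_recl big_ord0 addr0 !mxE /= -!monomialD.
  by apply: puiseux_eq => q /=; rewrite rmorphD /= !rmorph_nat.
have pos i j := pos_atD (pos_at_monomial R (u' i + a' j))
                        (pos_at_monomial R (v' i + b' j)).
exists (map_mx (fun f => ratr (pval f)) (U *m V)); split.
  exists (U *m V) => //; split; first exact: mulmx_max_rank.
  move=> i j; rewrite xE; eexists; last reflexivity.
  exact: pos_at_positive (pos i j).
apply: eS; split=> // i j; rewrite mxE xE.
rewrite (pos_at_pval (pos_at_pmap (pos i j))) E minr_rat !rmorphD /=.
have := Hu i; have := Hv i; have := Ha j; have := Hb j.
rewrite /ball /= !ltr_norml => /andP[? ?] /andP[? ?] /andP[? ?] /andP[? ?].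
by case: (leP (u i + a j)) => ?;
  case: (leP (ratr (u' i) + ratr (a' j))) => ?; apply/andP; split; lra.
Qed.

End Barvinok.

(** * Closing the cycle of inclusions *)

Lemma Rplus_Cplus (R : realType) : @Rplus R `<=` @Cplus R.
Proof.
by move=> _ [f /positive_pos_at/pos_at_pmap f0 <-]; apply: pos_at_positive f0.
Qed.

Theorem theorem2p3 (R : realType) (d n : nat) (hd : (2 <= d)%N)
    (hn : (2 <= n)%N) :
  trop (@Cplus R) (@rank_le R 2 d n) = trop (@Rplus R) (@rank_le R 2 d n) /\
  trop (@Rplus R) (@rank_le R 2 d n) =
    [set A : 'M[R]_(d, n) | (barvinok_rank A <= 2)%N].
Proof.
pose i0 := Ordinal (ltnW hd); pose j0 := Ordinal (ltnW hn).
have BR : [set A : 'M[R]_(d, n) | (barvinok_rank A <= 2)%N] `<=`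
    trop (@Rplus R) (@rank_le R 2 d n).
  by move=> A /(barvinok_rank_le2 A i0 j0)/trop_rank2_lift.
have RC : trop (@Rplus R) (@rank_le R 2 d n) `<=`
    trop (@Cplus R) (@rank_le R 2 d n).
  apply: closure_subset => _ [x [rkx posx] <-]; exists x => //; split=> // i j.
  exact: Rplus_Cplus.
have CB : trop (@Cplus R) (@rank_le R 2 d n) `<=`
    [set A : 'M[R]_(d, n) | (barvinok_rank A <= 2)%N].
  move=> A clA; apply/(barvinok_rank_le2 A i0 j0)/balanced_trop_rank2 => //.
  apply: closure_balanced; apply: closure_subset clA => _ [x [rkx posx] <-].
  move=> i1 i2 i3 j1 j2 j3; have := rank2_balanced rkx posx i1 i2 i3 j1 j2 j3.
  by rewrite /cyclic_min !mxE.
by split; apply/seteqP; split=> // A; [move=> /CB/BR | move=> /RC/CB].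
Qed.
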